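(* Let $N \geq 1$ be an integer, let $u:[0,1]\to\mathbb{R}$ be monotonic increasing, and let $B_N[u]$ denote the Bernstein reconstruction of $u$ of degree $N$. Then $B_N[u]$ is monotonic increasing on $[0,1]$ as well.
   Context: The Bernstein reconstruction of degree $N$ of a function $u:[0,1]\to\mathbb{R}$ is the polynomial $$B_N[u](x) = \sum_{n=0}^N u\left(\frac{n}{N}\right) b_{n,N}(x), \qquad b_{n,N}(x) = \binom{N}{n} x^n (1-x)^{N-n}, \quad x \in [0,1].$$ ''Monotonic increasing'' is meant in the weak sense: $v$ is monotonic increasing on $[0,1]$ if $v(x) \leq v(y)$ for all $x,y\in[0,1]$ with $x \leq y$. The function $u$ may be discontinuous. *)

(* Defs.v *)
From HB Require Import structures.
From mathcomp Require Import all_boot all_order all_algebra.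
From mathcomp Require Import reals.

Set Implicit Arguments.
Unset Strict Implicit.
Unset Printing Implicit Defensive.

Import Order.TTheory GRing.Theory Num.Theory.

Local Open Scope ring_scope.

(* The exponent N - n is a truncated subtraction, so this is the usual
   Bernstein basis polynomial for n <= N. *)
Definition bernstein_basis (R : realType) (N n : nat) : {poly R} :=
  'C(N, n)%:R *: ('X^n * (1 - 'X) ^+ (N - n)).

(* A function on [0, 1] is represented by u : R -> R; for 0 < N only its
   values at points of [0, 1] are used here. *)
Definition bernstein (R : realType) (N : nat) (u : R -> R) : {poly R} :=
  \sum_(n < N.+1) u (n%:R / N%:R) *: bernstein_basis R N n.

Definition monotonic_increasing01 (R : realType) (v : R -> R) : Prop :=
  {in `[0, 1] &, {homo v : x y / x <= y}}.

(* Main.v *)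
Require Import Defs.
From mathcomp Require Import all_boot all_order all_algebra.
From mathcomp Require Import reals.
From mathcomp Require Import ring.

Import Order.TTheory GRing.Theory Num.Theory.

Local Open Scope ring_scope.

(** The proof avoids derivatives and rests on the de Casteljau recursion: by
    Pascal's rule, the Bernstein form with coefficients f(0), ..., f(N+1) is
    the convex combination, with weights 1 - x and x, of the degree N forms
    with coefficients f(0), ..., f(N) and f(1), ..., f(N+1)
    ([bernstein_form_recS]). If f is nondecreasing, both degree N forms are
    nondecreasing in x by induction on N, and the second dominates the first
    because the basis is nonnegative on [0, 1] ([ler_bernstein_form]). Moving
    from x to y >= x thus increases both forms and also shifts weight towards
    the larger one ([bernstein_form_homo]). *)

(** The coefficients are an arbitrary sequence rather than samples of a
    function, because the induction shifts them while lowering the degree,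
    which sampling at n / N would not allow. *)
Definition bernstein_form (R : realType) (N : nat) (f : nat -> R) : {poly R} :=
  \sum_(n < N.+1) f n *: bernstein_basis R N n.

Lemma bernstein_basis_small (R : realType) (N n : nat) :
  (N < n)%N -> bernstein_basis R N n = 0.
Proof. by move=> ltNn; rewrite /bernstein_basis bin_small// scale0r. Qed.

Lemma bernstein_basis_recS0 (R : realType) (N : nat) :
  bernstein_basis R N.+1 0 = (1 - 'X) * bernstein_basis R N 0.
Proof.
by rewrite /bernstein_basis !bin0 !scale1r !expr0 !mul1r !subn0 exprS.
Qed.

Lemma bernstein_basis_recS (R : realType) (N n : nat) :
  bernstein_basis R N.+1 n.+1 =
  (1 - 'X) * bernstein_basis R N n.+1 + 'X * bernstein_basis R N n.
Proof.
rewrite /bernstein_basis binS natrD scalerDl -!scalerAr subSS.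
congr (_ + _); last by rewrite mulrA -exprS.
(* For n >= N the exponents differ, but the binomial coefficient vanishes. *)
have [ltnN | leNn] := ltnP n N; last by rewrite bin_small ?ltnS// !scale0r.
by rewrite mulrCA -exprS subnSK.
Qed.

Lemma bernstein_form_recS (R : realType) (N : nat) (f : nat -> R) :
  bernstein_form R N.+1 f =
  (1 - 'X) * bernstein_form R N f + 'X * bernstein_form R N (f \o succn).
Proof.
(* The null term of index N + 1 makes the sums over 0, ..., N + 1 match. *)
have -> : bernstein_form R N f =
    \sum_(n < N.+2) f n *: bernstein_basis R N n.
  by rewrite big_ord_recr /= bernstein_basis_small// scaler0 addr0.
rewrite /bernstein_form !(big_ord_recl N.+1) /= mulrDr -addrA.
rewrite bernstein_basis_recS0; congr (_ + _); first by rewrite scalerAr.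
rewrite !mulr_sumr -big_split /=; apply: eq_bigr => i _.
by rewrite bernstein_basis_recS scalerDr !scalerAr.
Qed.

Lemma bernstein_basis_ge0 (R : realType) (N n : nat) (x : R) :
  x \in `[0, 1] -> 0 <= (bernstein_basis R N n).[x].
Proof.
rewrite in_itv /= => /andP[x0 x1]; rewrite /bernstein_basis !hornerE.
by rewrite !mulr_ge0 ?ler0n ?exprn_ge0 ?subr_ge0.
Qed.

Lemma ler_bernstein_form (R : realType) (N : nat) (f g : nat -> R) (x : R) :
  x \in `[0, 1] -> (forall n, (n <= N)%N -> f n <= g n) ->
  (bernstein_form R N f).[x] <= (bernstein_form R N g).[x].
Proof.
move=> x01 lefg; rewrite /bernstein_form !horner_sum; apply: ler_sum => n _.
rewrite (hornerZ (f n)) (hornerZ (g n)); apply: ler_wpM2r; first exact: bernstein_basis_ge0.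
by apply: lefg; rewrite -ltnS.
Qed.

Lemma bernstein_form_homo (R : realType) (N : nat) (f : nat -> R) :
  (forall n, (n < N)%N -> f n <= f n.+1) ->
  monotonic_increasing01 (fun x : R => (bernstein_form R N f).[x]).
Proof.
elim: N f => [|N IH] f f_incr x y x01 y01 lexy.
  by rewrite /bernstein_form big_ord1 /bernstein_basis !hornerE.
have lef : (bernstein_form R N f).[x] <= (bernstein_form R N f).[y].
  by apply: IH => // n ltnN; rewrite f_incr// ltnW.
have leg : (bernstein_form R N (f \o succn)).[x]
         <= (bernstein_form R N (f \o succn)).[y].
  by apply: IH => // n ltnN; rewrite f_incr.
have lefg : (bernstein_form R N f).[x]
         <= (bernstein_form R N (f \o succn)).[x].
  by apply: ler_bernstein_form.
move: y01; rewrite in_itv /= => /andP[y0 y1].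
rewrite bernstein_form_recS !hornerE.
move: lef leg lefg; set a := _.[x]; set b := _.[y].
set c := (bernstein_form R N (f \o succn)).[x]; set d := _.[y].
move=> leab lecd leac; rewrite -subr_ge0.
(* Growth of the two forms at the weights of y, then the transfer of weight
   y - x from the smaller form to the larger one. *)
have -> : (1 - y) * b + y * d - ((1 - x) * a + x * c) =
    (1 - y) * (b - a) + y * (d - c) + (y - x) * (c - a) by ring.
by rewrite !addr_ge0 ?mulr_ge0 ?subr_ge0.
Qed.

Theorem lemma10 (R : realType) (N : nat) (hN : (1 <= N)%N) (u : R -> R)
    (hu : monotonic_increasing01 u) :
  monotonic_increasing01 (fun x : R => (bernstein N u).[x]).
Proof.
have N_gt0 : (0 : R) < N%:R by rewrite ltr0n.
have node01 n : (n <= N)%N -> n%:R / N%:R \in `[0 : R, 1].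
  by move=> lenN; rewrite in_itv /= divr_ge0 //= ler_pdivrMr// mul1r ler_nat.
apply: (@bernstein_form_homo R N (fun n => u (n%:R / N%:R))) => n ltnN.
apply: hu; [exact/node01/ltnW | exact: node01 |].
by rewrite ler_pM2r ?invr_gt0// ler_nat.
Qed.
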